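(* Let $L=[a,b]$ be a closed interval of $\overline{\mathbb{R}}=\mathbb{R}\cup\{-\infty,+\infty\}$, let $n\geqslant 1$, let $X_1,\ldots,X_n$ be independent $L$-valued random variables, $X_i$ having cumulative distribution function $F_i$. Let $p:L^n\to L$ be any weighted lattice polynomial function, let $Y_p:=p(X_1,\ldots,X_n)$, and let $g:\overline{\mathbb{R}}\to\overline{\mathbb{R}}$ be any measurable function of bounded variation. If $\lim_{y\to\infty}g(y)[1-F_i(y)]=0$ for all $i\in[n]$, then $$\mathbf{E}[g(Y_p)]=g(-\infty)+\sum_{S\subseteq [n]}\int_{-\infty}^{p(\mathbf{e}_S)}\;\prod_{i\in [n]\setminus S}F_i(y)\,\prod_{i\in S}[1-F_i(y)] \,\mathrm{d} g(y).$$
   Context: Notation: $[n]=\{1,\ldots,n\}$; $\wedge=\min$, $\vee=\max$. The class of weighted lattice polynomial functions from $L^n$ to $L$ is the smallest class of functions $L^n\to L$ that contains all projections $(x_1,\ldots,x_n)\mapsto x_k$ ($k\in[n]$) and all constant functions $(x_1,\ldots,x_n)\mapsto c$ ($c\in L$), and is closed under pointwise $\wedge$ and pointwise $\vee$. For $S\subseteq[n]$, $\mathbf{e}_S\in\{a,b\}^n$ is the vector whose $i$th component is $b$ if $i\in S$ and $a$ otherwise. Cumulative distribution functions are $F_i(y)=\Pr[X_i\leqslant y]$ and $F_p(y)=\Pr[Y_p\leqslant y]$. The expected value is, by definition, the Stieltjes integral $\mathbf{E}[g(Y_p)]=\int_{-\infty}^{\infty}g(y)\,\mathrm{d}F_p(y)$,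 and integrals $\int\cdots\,\mathrm{d}g(y)$ are likewise Stieltjes integrals with respect to $g$. Empty products equal $1$.
   Formalization: The formal theorem additionally assumes that the Stieltjes integrals with respect to g on the right-hand side exist; this can fail when g and some F_i jump at the same point (e.g. X=0 almost surely, g the indicator of [0,∞]). *)

(* Defs.v *)
From HB Require Import structures.
From mathcomp Require Import all_boot all_order all_algebra.
From mathcomp Require Import all_classical all_reals all_analysis.
From mathcomp Require Import measurable_realfun.

Set Implicit Arguments.
Unset Strict Implicit.
Unset Printing Implicit Defensive.

Import Order.TTheory GRing.Theory Num.Theory.
Import numFieldNormedType.Exports.

Local Open Scope classical_set_scope.
Local Open Scope ring_scope.
Local Open Scope ereal_scope.

(* The chain L = [a, b] in the extended reals, with the inherited order, so
   that Order.min and Order.max on it are the lattice operations of L. *)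
Record eitv (R : realType) (a b : \bar R) : Type := Eitv {
  eitv_val :> \bar R;
  eitv_valP : a <= eitv_val <= b
}.

Section eitv_instances.
Context (R : realType) (a b : \bar R).
HB.instance Definition _ := [isSub for @eitv_val R a b].
HB.instance Definition _ := [Choice of eitv a b by <:].
HB.instance Definition _ :=
  [SubChoice_isSubOrder of eitv a b by <: with ereal_display].
End eitv_instances.

Definition eitv_left (R : realType) (a b : \bar R) (ab : a <= b) : eitv a b :=
  Eitv (introT andP (conj (lexx a) ab)).

Definition eitv_right (R : realType) (a b : \bar R) (ab : a <= b) : eitv a b :=
  Eitv (introT andP (conj ab (lexx b))).

Inductive weighted_lattice_polynomial (R : realType) (a b : \bar R) (n : nat) :
    (('I_n -> eitv a b) -> eitv a b) -> Prop :=
| wlp_proj (k : 'I_n) : weighted_lattice_polynomial (fun x => x k)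
| wlp_const (c : eitv a b) : weighted_lattice_polynomial (fun=> c)
| wlp_min p q :
    weighted_lattice_polynomial p -> weighted_lattice_polynomial q ->
    weighted_lattice_polynomial (fun x => Order.min (p x) (q x))
| wlp_max p q :
    weighted_lattice_polynomial p -> weighted_lattice_polynomial q ->
    weighted_lattice_polynomial (fun x => Order.max (p x) (q x)).

Definition vertex (R : realType) (a b : \bar R) (ab : a <= b) (n : nat)
    (S : {set 'I_n}) (i : 'I_n) : eitv a b :=
  if i \in S then eitv_right ab else eitv_left ab.

Definition ecdf (d : measure_display) (T : measurableType d) (R : realType)
    (P : probability T R) (Z : T -> \bar R) (y : \bar R) : \bar R :=
  P [set t | Z t <= y].

Definition mutually_independent (d : measure_display) (T : measurableType d)
    (R : realType) (P : probability T R) (n : nat)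
    (Z : 'I_n -> T -> \bar R) : Prop :=
  forall (J : {set 'I_n}) (A : 'I_n -> set (\bar R)),
    (forall i, measurable (A i)) ->
    P (\bigcap_(i in [set` J]) (Z i @^-1` A i)) =
    \prod_(i in J) P (Z i @^-1` A i).

(* x < s_0 < ... < s_k ranges over all finite increasing sequences of extended
   reals.  As `|x - y| = +oo when x or y is infinite, a function of bounded
   variation is finite everywhere, including at -oo and +oo. *)
Definition ebounded_variation (R : realType) (g : \bar R -> \bar R) : Prop :=
  exists M : R, forall (x : \bar R) (s : seq (\bar R)), path <%O x s ->
    \sum_(j < size s) `|g (nth x (x :: s) j.+1) - g (nth x (x :: s) j)| <= M%:E.

(* The Lebesgue-Stieltjes measures on the extended line associated with a
   distribution function F; atoms at -oo and +oo are allowed. *)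
Definition stieltjes_measure (R : realType) (F : \bar R -> \bar R)
    (mu : {measure set (\bar R) -> \bar R}) : Prop :=
  forall y : \bar R, mu [set z | z <= y] = F y.

(* Riemann-Stieltjes integrals over [u, v], a compact interval of the extended
   line: u and v may be infinite, and are then division points like any other.
   A division u = s_0 < s_1 < ... < s_k = v is represented by the list
   s_1, ..., s_k, and its j-th tag lies in the closed j-th cell. *)
Definition division (R : realType) (u v : \bar R) (s : seq (\bar R)) : Prop :=
  path <%O u s /\ last u s = v.

Definition tags (R : realType) (u : \bar R) (s t : seq (\bar R)) : Prop :=
  size t = size s /\
  forall j : nat, (j < size s)%N ->
    nth u (u :: s) j <= nth u t j <= nth u (u :: s) j.+1.

Definition stieltjes_sum (R : realType) (f h : \bar R -> \bar R) (u : \bar R)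
    (st : seq (\bar R) * seq (\bar R)) : \bar R :=
  \sum_(j < size st.1)
    f (nth u st.2 j) *
    (h (nth u (u :: st.1) j.+1) - h (nth u (u :: st.1) j)).

(* Limits are taken along refinement of divisions (Moore-Pollard).  On a finite
   interval, whenever the limit along the mesh exists, so does this one, with
   the same value. *)
Definition refinements (R : realType) (u v : \bar R) :
    set_system (seq (\bar R) * seq (\bar R)) :=
  [set A | exists2 s0 : seq (\bar R), division u v s0 &
    forall s t : seq (\bar R), division u v s -> {subset s0 <= s} ->
      tags u s t -> A (s, t)].

(* Bounded variation of f and h does not ensure existence: for h = 1_[0, +oo]
   and f = 1_[-oo, 0[, the sums over [-1, 1] keep taking both values 0 and 1. *)
Definition stieltjes_integrable (R : realType) (f h : \bar R -> \bar R)
    (u v : \bar R) : Prop :=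
  cvg (stieltjes_sum f h u @ refinements u v).

Definition stieltjes_integral (R : realType) (f h : \bar R -> \bar R)
    (u v : \bar R) : \bar R :=
  lim (stieltjes_sum f h u @ refinements u v).

(* Main.v *)
(** A weighted lattice polynomial commutes with thresholding: [Y_p > y] holds
    iff [p(e_S) > y] for [S = {i | X_i > y}].  By independence this gives the
    pointwise identity [1 - F_p(y) = \sum_(S | y < p(e_S)) f_S(y)], where [f_S]
    is the integrand of the theorem.  Hence, for a division [s] of [-oo, +oo]
    containing the points [p(e_S)] and tagged at left endpoints, [g(-oo)] plus
    the Stieltjes sums of the right-hand side is exactly the integral against
    [dF_p] of the step function sending [y] to [g(c)], where [c] is the least
    point of [s] that is at least [y].  As [g] has bounded variation, there are
    divisions, refining any given one, whose step functions converge to [g]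
    everywhere: the [m]-th one contains the finitely many points where [g] has
    a right jump larger than [1/(m+1)], and the first [m] rationals.  Dominated
    convergence concludes. *)

Require Import Defs.
From HB Require Import structures.
From mathcomp Require Import all_boot all_order all_algebra.
From mathcomp Require Import all_classical all_reals all_analysis.
From mathcomp Require Import measurable_realfun.
From mathcomp Require Import ring lra.
Import Order.TTheory GRing.Theory Num.Theory.
Import numFieldNormedType.Exports.
Local Open Scope classical_set_scope.
Local Open Scope ring_scope.
Local Open Scope ereal_scope.

(** * Sums over the cells of a chain *)

Section cell_sum.
Context {R : realType}.
Implicit Types (w : \bar R -> \bar R -> R) (g : \bar R -> R).
Implicit Types (x y z : \bar R) (s : seq (\bar R)).

(** Structural recursion replaces the indexed sums of [stieltjes_sum] and [ebounded_variation], so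
    that facts about chains go by induction on the list. *)
Fixpoint cell_sum w x s : R :=
  if s is z :: s' then (w x z + cell_sum w z s')%R else 0%R.

Lemma cell_sumE w x0 x s :
  (\sum_(j < size s) w (nth x0 (x :: s) j) (nth x0 (x :: s) j.+1))%R =
  cell_sum w x s.
Proof.
elim: s x => [|z s IH] x /=; first by rewrite big_ord0.
by rewrite big_ord_recl /= -IH.
Qed.

Lemma eq_cell_sum w w' x s :
  (forall u v, u \in x :: s -> w u v = w' u v) ->
  cell_sum w x s = cell_sum w' x s.
Proof.
elim: s x => [//|z s IH] x ww' /=.
by rewrite ww' ?mem_head// IH// => u v us; apply: ww'; rewrite in_cons us orbT.
Qed.

Lemma cell_sum_eq0 w x s :
  (forall u v, u \in x :: s -> w u v = 0%R) -> cell_sum w x s = 0%R.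
Proof.
move=> w0; rewrite (eq_cell_sum w (fun _ _ => 0%R))//.
by elim: s x {w0} => [//|z s IH] x /=; rewrite IH addr0.
Qed.

Lemma le_cell_sum w w' x s : (forall u v, w u v <= w' u v)%R ->
  (cell_sum w x s <= cell_sum w' x s)%R.
Proof. by move=> ww'; elim: s x => [//|z s IH] x /=; rewrite lerD. Qed.

Lemma normr_cell_sum w x s :
  (`|cell_sum w x s| <= cell_sum (fun u v => `|w u v|) x s)%R.
Proof.
elim: s x => [|z s IH] x /=; first by rewrite normr0.
by rewrite (le_trans (ler_normD _ _))// lerD.
Qed.

Lemma cell_sum_sum (I : finType) (w : I -> \bar R -> \bar R -> R) x s :
  (\sum_i cell_sum (w i) x s)%R = cell_sum (fun u v => \sum_i w i u v)%R x s.
Proof.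
elim: s x => [|z s IH] x /=; first by rewrite big1.
by rewrite big_split /= IH.
Qed.

Lemma path_min {x s} : path <%O x s ->
  forall {z}, z \in x :: s -> x <= z.
Proof.
move=> /(order_path_min lt_trans) /allP xs z; rewrite in_cons => /predU1P[->//|].
by move/xs/ltW.
Qed.

(** As [v] is a point of the chain, no cell straddles it: truncation at [v] keeps exactly the cells
    whose left endpoint is below [v]. This brings integrals with different upper bounds to one
    common division. *)
Lemma cell_sum_filter (f : \bar R -> R) g x s v :
  path <%O x s -> x <= v -> v \in x :: s ->
  cell_sum (fun y z => f y * (g z - g y))%R x [seq z <- s | z <= v] =
  cell_sum (fun y z => (y < v)%E%:R * f y * (g z - g y))%R x s.
Proof.
elim: s x => [//|z s IH] x xs xv vs.
have /andP[xz zs] : (x < z) && path <%O z s by [].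
have [zv|vz] := leP z v.
- rewrite /= zv /= IH//; first by rewrite (lt_le_trans xz zv) mul1r.
  move: vs; rewrite in_cons => /predU1P[vx|//].
  by move: (lt_le_trans xz zv); rewrite vx ltxx.
(* Here [v] can only be [x], and both sides vanish. *)
- have s_gt u : u \in z :: s -> v < u.
    by move=> us; exact: lt_le_trans vz (path_min zs us).
  have -> : [seq z <- z :: s | z <= v] = [::].
    apply/eqP; rewrite -(negbK (_ == _)) -has_filter; apply/hasPn => u us.
    by rewrite -ltNge s_gt.
  rewrite [RHS]cell_sum_eq0// => u u' us.
  suff -> : (u < v) = false by rewrite !mul0r.
  have vx : v = x.
    move: vs; rewrite in_cons => /predU1P[//|vs].
    by move: (s_gt _ vs); rewrite ltxx.
  by apply/negbTE; rewrite -leNgt vx; exact: (path_min xs us).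
Qed.

(* The left-tag step function of [g] takes at [y] the value of [g] at the
   smallest division point that is at least [y]. *)
Lemma step_value g x s y : path <%O x s -> y <= last x s ->
  exists c, [/\ c \in x :: s, y <= c,
    (forall z, z \in x :: s -> y <= z -> c <= z) &
    (g x + cell_sum (fun u v => (u < y)%E%:R * (g v - g u)) x s = g c)%R].
Proof.
elim: s x => [|z s IH] x xs ys.
  exists x; split => //; rewrite ?mem_head//= ?addr0//.
  by move=> z; rewrite inE => /eqP ->.
have /andP[xz zs] : (x < z) && path <%O z s by [].
have [yx|xy] := leP y x.
  exists x; split => //; rewrite ?mem_head//.
    by move=> u us _; exact: (path_min xs us).
  rewrite cell_sum_eq0 ?addr0// => u v us.
  suff -> : (u < y) = false by rewrite mul0r.
  by apply/negbTE; rewrite -leNgt (le_trans yx)//; exact: (path_min xs us).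
have [c [cs yc cmin cE]] := IH _ zs ys.
exists c; split => //; first by rewrite in_cons cs orbT.
  move=> u; rewrite in_cons => /predU1P[->|]; last exact: cmin.
  by rewrite leNgt xy.
by rewrite -cE /= xy mul1r; lra.
Qed.

End cell_sum.

(** * Divisions with prescribed points *)

Section divisions.
Context {R : realType}.
Implicit Types (x y z v : \bar R) (l s : seq (\bar R)).

Lemma path_max x s : path <%O x s -> forall z, z \in x :: s -> z <= last x s.
Proof.
elim: s x => [|z s IH] x xs u; first by rewrite inE => /eqP ->.
have /andP[xz zs] : (x < z) && path <%O z s by [].
rewrite in_cons => /predU1P[->|]; last exact: IH.
by rewrite (le_trans (ltW xz))// IH// mem_head.
Qed.

Lemma exists_division v l : (forall z, z \in l -> z <= v) ->
  exists2 s, division -oo v s &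
    forall z, (z \in s) = (-oo < z) && ((z == v) || (z \in l)).
Proof.
move=> lv; pose s := sort <=%O (undup [seq z <- v :: l | -oo < z]).
have memsE z : (z \in s) = (-oo < z) && ((z == v) || (z \in l)).
  by rewrite mem_sort mem_undup mem_filter in_cons.
have ps : path <%O -oo s.
  rewrite (path_sortedE lt_trans) sort_lt_sorted undup_uniq andbT.
  by apply/allP => z; rewrite memsE => /andP[].
exists s => //; split => //; apply/eqP; rewrite eq_le.
have := mem_last -oo s; rewrite in_cons => /predU1P[s_nil|].
- rewrite s_nil leNye /= leNgt; apply/negP => vNy.
  have : v <= last -oo s by apply: (path_max _ _ ps); rewrite in_cons memsE vNy eqxx orbT.
  by rewrite s_nil leNgt vNy.
- rewrite memsE => /andP[Nys /predU1P[->|/lv sv]]; first by rewrite lexx.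
  rewrite sv /=; have [->|vNy] := eqVneq v -oo; first by rewrite leNye.
  apply: (path_max _ _ ps).
  by rewrite in_cons memsE eqxx andbT ltNye vNy orbT.
Qed.

Lemma ereal_rat_between y z : y < z -> exists q : rat, y < (ratr q)%:E < z.
Proof.
have real_rat (r t : R) : (r < t)%R -> exists q : rat, r%:E < (ratr q)%:E < t%:E.
  by move=> /rat_in_itvoo[q]; rewrite in_itv /= => qrt; exists q; rewrite !lte_fin.
case: y z => [r||] [t||] //=.
- by rewrite lte_fin; exact: real_rat.
- have [|q /andP[rq _]] := real_rat r (r + 1)%R; first by lra.
  by exists q; rewrite rq ltry.
- have [|q /andP[_ qt]] := real_rat (t - 1)%R t; first by lra.
  by exists q; rewrite qt ltNyr.
- by exists 0%R; rewrite ltNyr ltry.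
Qed.

End divisions.

(** * Right jumps and step approximation of functions of bounded variation *)

Section right_jumps.
Context {R : realType}.
Variables (g : \bar R -> R) (M : R).
Implicit Types (x y z : \bar R) (l s : seq (\bar R)).

Hypothesis bvg : forall x s, path <%O x s ->
  (cell_sum (fun u v => `|g v - g u|) x s <= M)%R.

(** Phrased through values at nearby points, so that no right limit has to be constructed. The point
    [+oo] is excluded because the condition on [w] is vacuous there. *)
Definition right_jump (k : nat) : set (\bar R) :=
  [set y | y < +oo /\
    forall w, y < w -> exists2 z, y < z < w & (k.+1%:R^-1 < `|g z - g y|)%R].

Lemma right_jump_mono k m : (k <= m)%N -> right_jump k `<=` right_jump m.
Proof.
move=> km y [yoo yP]; split => // w /yP[z yzw jz]; exists z => //.
by rewrite (le_lt_trans _ jz)// lef_pV2 ?posrE// ler_nat ltnS.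
Qed.

(* A jump on the right of [x] is seen between [x] and a point below the next
   element of the chain, so that the jumps of a chain add up. *)
Lemma right_jump_chain k x s : path <%O x s ->
  (forall z, z \in x :: s -> right_jump k z) ->
  exists2 t, path <%O x t &
    ((size s).+1%:R * k.+1%:R^-1 <= cell_sum (fun u v => `|g v - g u|) x t)%R.
Proof.
elim: s x => [|y s IH] x xs jump.
  have [xoo /(_ _ xoo)[z /andP[xz _] jz]] := jump x (mem_head _ _).
  by exists [:: z]; rewrite /= ?xz// mul1r addr0 ltW.
have /andP[xy ys] : (x < y) && path <%O y s by [].
have [|t yt tge] := IH y ys.
  by move=> z zs; apply: jump; rewrite in_cons zs orbT.
have [_ /(_ _ xy)[z /andP[xz zy] jz]] := jump x (mem_head _ _).
exists (z :: y :: t); first by rewrite /= xz zy.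
rewrite [size _]/= -natr1 mulrDl mul1r addrC /=.
by rewrite lerD ?(ltW jz)// (le_trans tge)// lerDr.
Qed.

(** Enough jump points, put in a chain, would force a variation larger than [M]. *)
Lemma finite_right_jump k : finite_set (right_jump k).
Proof.
apply: contrapT => inf.
(* With this [n], already [n / (k + 1)] exceeds [M], while [n + 1] jumps give at least
   [(n + 1) / (k + 1)]. *)
pose n := Num.bound `|M * k.+1%:R|%R.
have Mn : (M < n%:R * k.+1%:R^-1)%R.
  rewrite ltr_pdivlMr//; apply: le_lt_trans (ler_norm _) _.
  by rewrite archi_boundP.
have [B Bj nB] := infinite_set_fset n.+1 inf.
have := sort_lt_sorted (finmap.enum_fset B); rewrite finmap.fset_uniq.
have memB z : z \in sort <=%O (finmap.enum_fset B) -> right_jump k z.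
  by rewrite mem_sort => zB; exact: Bj.
move: nB memB; rewrite -(size_sort <=%O); case: sort => [//|x s] ns memB xs.
have [t xt tge] := right_jump_chain k x s xs memB.
have := le_trans tge (bvg _ _ xt); rewrite leNgt => /negP; apply.
by rewrite (lt_le_trans Mn)// ler_wpM2r// ler_nat ltnW.
Qed.

(** A right jump is eventually a division point, where the step function agrees with [g]. At any
    other [y < +oo], [g] stays close to [g y] just to the right of [y], and a rational division
    point eventually falls there. The points of [l] make the divisions refine a given one; [-oo] is
    left out since a division does not list its left end. *)
Lemma exists_step_approximation l : exists s_ : nat -> seq (\bar R),
  [/\ forall m, division -oo +oo (s_ m),
      forall m z, -oo < z -> z \in l -> z \in s_ m &
      forall y, (g -oo +
        cell_sum (fun u v => (u < y)%E%:R * (g v - g u)) -oo (s_ m))%R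
        @[m --> \oo] --> g y].
Proof.
have /choice[J JP] k : exists J : seq (\bar R), forall y, right_jump k y -> y \in J.
  by have /finite_seqP[J ->] := finite_right_jump k; exists J.
(* The rationals with code below [m]: each rational belongs to all grids from some index on. *)
pose grid m : seq (\bar R) :=
  pmap (fun i => omap (fun q : rat => (ratr q)%:E) (unpickle i)) (iota 0 m).
have /choice[s_ s_P] m : exists s, division -oo +oo s /\
    forall z, (z \in s) = (-oo < z) && ((z == +oo) || (z \in l ++ J m ++ grid m)).
  have [z _|s ds sE] := exists_division +oo (l ++ J m ++ grid m).
    exact: leey.
  by exists s.
exists s_; split.
- by move=> m; have [] := s_P m.
- by move=> m z z0 zl; have [_ ->] := s_P m; rewrite z0 mem_cat zl !orbT.
move=> y; apply/cvgrPdist_le => e e0.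
pose value m c := [/\ y <= c,
    (forall z, z \in -oo :: s_ m -> y <= z -> c <= z) &
    (g -oo + cell_sum (fun u v => (u < y)%E%:R * (g v - g u)) -oo (s_ m) = g c)%R].
have valueP m : exists c, value m c.
  have [[ps ls] _] := s_P m.
  have [|c [_ yc cmin cE]] := step_value g -oo (s_ m) y ps; first by rewrite ls leey.
  by exists c.
have value_self m c : y \in -oo :: s_ m -> value m c -> c = y.
  by move=> ys [yc cmin _]; apply: le_anti; rewrite yc cmin.
pose k := Num.bound e^-1.
have ke : (k.+1%:R^-1 <= e)%R.
  rewrite invf_ple ?posrE// ltW// (lt_le_trans (archi_boundP _))//.
    by rewrite invr_ge0 ltW.
  by rewrite ler_nat.
(* For [m >= k'], a jump of level [k'] is one of level [m], so [y] is a point of [s_ m]. *)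
have [[k' jy]|nojump] := pselect (exists k, right_jump k y).
  near=> m.
  have [c cP] := valueP m; have [_ _ ->] := cP.
  rewrite (value_self _ _ _ cP) ?subrr ?normr0 ?(ltW e0)//.
  rewrite in_cons; have [//|yNy] := eqVneq y -oo.
  have [_ ->] := s_P m; rewrite ltNye yNy /= mem_cat mem_cat.
  suff -> : y \in J m by rewrite !orbT.
  apply: JP; apply: right_jump_mono jy.
  by near: m; exact: nbhs_infty_ge.
have [yoo|yoo] := eqVneq y +oo.
  near=> m; have [c cP] := valueP m; have [yc _ ->] := cP.
  by move: yc; rewrite yoo leye_eq => /eqP ->; rewrite subrr normr0 ltW.
have [w yw wP] : exists2 w, y < w &
    forall z, y < z < w -> (`|g z - g y| <= k.+1%:R^-1)%R.
  apply: contrapT => nw; apply: nojump; exists k; split; first by rewrite ltey.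
  move=> w yw; apply: contrapT => nz; apply: nw; exists w => // z yzw.
  by rewrite leNgt; apply/negP => jz; apply: nz; exists z.
have [q /andP[yq qw]] := ereal_rat_between y w yw.
(* Once [q] is a division point, minimality of [c] gives [y <= c <= q < w]. *)
near=> m; have [c [yc cmin ->]] := valueP m.
have [->|cy] := eqVneq c y; first by rewrite subrr normr0 ltW.
rewrite distrC (le_trans (wP _ _))// lt_neqAle eq_sym cy yc /=.
rewrite (le_lt_trans _ qw)// cmin// ?(ltW yq)// in_cons.
have [_ ->] := s_P m; rewrite ltNyr !mem_cat /grid.
suff -> : (ratr q)%:E \in grid m by rewrite !orbT.
rewrite /grid mem_pmap; apply/mapP; exists (pickle q); last by rewrite pickleK.
rewrite mem_iota /= add0n; near: m; exact: nbhs_infty_gt.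
Unshelve. all: by end_near.
Qed.

End right_jumps.

(** * Thresholds of weighted lattice polynomials *)

Section wlp.
Context {R : realType} {a b : \bar R}.
Implicit Types (x y : \bar R) (n : nat).

Lemma lt_eitv_min y (u v : eitv a b) :
  (y < eitv_val (Order.min u v)) = (y < eitv_val u) && (y < eitv_val v).
Proof.
rewrite -lt_min !minElt.
have -> : (u < v)%O = (eitv_val u < eitv_val v) by [].
by case: ifP.
Qed.

Lemma lt_eitv_max y (u v : eitv a b) :
  (y < eitv_val (Order.max u v)) = (y < eitv_val u) || (y < eitv_val v).
Proof.
rewrite -lt_max !maxElt.
have -> : (u < v)%O = (eitv_val u < eitv_val v) by [].
by case: ifP.
Qed.

(** On a chain, [z |-> (y < z)] is a lattice homomorphism to the booleans, so induction on [p]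
    applies. *)
Lemma wlp_threshold n (p : ('I_n -> eitv a b) -> eitv a b) y
    (u v : 'I_n -> eitv a b) :
  weighted_lattice_polynomial p ->
  (forall i, (y < eitv_val (u i)) = (y < eitv_val (v i))) ->
  (y < eitv_val (p u)) = (y < eitv_val (p v)).
Proof.
move=> wp uv; elim: wp => [//|//|q r _ IHq _ IHr|q r _ IHq _ IHr].
- by rewrite !lt_eitv_min IHq IHr.
- by rewrite !lt_eitv_max IHq IHr.
Qed.

Lemma wlp_threshold_vertex (ab : a <= b) n
    (p : ('I_n -> eitv a b) -> eitv a b) y (u : 'I_n -> eitv a b)
    (S : {set 'I_n}) :
  weighted_lattice_polynomial p ->
  (forall i, (y < eitv_val (u i)) = (i \in S)) ->
  (y < eitv_val (p u)) = (y < eitv_val (p (vertex ab S))).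
Proof.
move=> wp uS.
(* Vertices separate the coordinates only for [a <= y < b]; for any other [y], all of [[a, b]] lies
   on one side of [y]. *)
have [ya|ay] := ltP y a.
  have lty (c : eitv a b) : y < eitv_val c.
    by have /andP[ac _] := eitv_valP c; exact: lt_le_trans ya ac.
  by rewrite !lty.
have [by_|yb] := leP b y.
  have gey (c : eitv a b) : (y < eitv_val c) = false.
    by apply/negbTE; rewrite -leNgt; have /andP[_ cb] := eitv_valP c; exact: le_trans cb by_.
  by rewrite !gey.
apply: wlp_threshold wp _ => i; rewrite uS /vertex.
by case: ifP => _ /=; rewrite ?yb// ltNge ay.
Qed.

End wlp.

(** * Tail probabilities of the polynomial of independent variables *)

Section tail.
Context {R : realType} {a b : \bar R} (ab : a <= b) {n : nat}.
Context {d : measure_display} {T : measurableType d} (P : probability T R).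
Variables (X : 'I_n -> T -> eitv a b).
Hypothesis mX : forall i, measurable_fun [set: T] (fun t => eitv_val (X i t)).
Hypothesis indepX : mutually_independent P (fun i t => eitv_val (X i t)).
Variables (p : ('I_n -> eitv a b) -> eitv a b).
Hypothesis wlp_p : weighted_lattice_polynomial p.

(** For fixed [y], these events partition [T] according to the set of indices whose variable exceeds
    [y]. *)
Definition exceedance_event (y : \bar R) (S : {set 'I_n}) : set T :=
  [set t | forall i, (y < eitv_val (X i t)) = (i \in S)].

Let side (y : \bar R) (S : {set 'I_n}) i : set (\bar R) :=
  [set z | (y < z) = (i \in S)].

Lemma measurable_gt (y : \bar R) : measurable [set z : \bar R | y < z].
Proof.
rewrite (_ : mkset _ = [set` `]y, +oo[])//; first exact: emeasurable_itv.
by apply/seteqP; split => z /=; rewrite in_itv /= andbT.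
Qed.

Lemma measurable_le (y : \bar R) : measurable [set z : \bar R | z <= y].
Proof.
rewrite (_ : mkset _ = ~` [set z : \bar R | y < z]).
  by apply: measurableC; exact: measurable_gt.
by apply/seteqP; split => z /=; rewrite leNgt => /negP.
Qed.

Let measurable_side y S i : measurable (side y S i).
Proof.
rewrite /side; case: (i \in S); first exact: measurable_gt.
rewrite (_ : mkset _ = [set z : \bar R | z <= y]); first exact: measurable_le.
by apply/seteqP; split => z /=; rewrite leNgt; [move=> ->|move=> /negbTE].
Qed.

Let exceedanceE y S : exceedance_event y S =
  \bigcap_(i in [set` [set: 'I_n]%SET])
    ((fun t => eitv_val (X i t)) @^-1` side y S i).
Proof.
apply/seteqP; split => t /= tS; first by move=> i _; exact: tS.
by move=> i; apply: (tS i); rewrite /= inE.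
Qed.

Let measurable_preimage i (A : set (\bar R)) : measurable A ->
  measurable ((fun t => eitv_val (X i t)) @^-1` A).
Proof. by move=> mA; rewrite -[X in measurable X]setTI; exact: mX. Qed.

Lemma measurable_exceedance_event y S : measurable (exceedance_event y S).
Proof.
rewrite exceedanceE; apply: fin_bigcap_measurable => [|i _]; last exact: measurable_preimage.
exact: finite_finset.
Qed.

(** Independence is applied to all indices at once, with one half-line per index; this identifies
    the integrand of the theorem as a probability. *)
Lemma probability_exceedance_event y S : P (exceedance_event y S) =
  \prod_(i in ~: S) ecdf P (fun t => eitv_val (X i t)) y *
  \prod_(i in S) (1 - ecdf P (fun t => eitv_val (X i t)) y).
Proof.
rewrite exceedanceE indepX; last exact: measurable_side.
rewrite (eq_bigl xpredT); last by move=> i; rewrite inE.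
rewrite (bigID (mem S)) /= muleC; congr (_ * _).
  apply: eq_big => [i|i iS]; first by rewrite inE.
  rewrite /ecdf; congr (P _); apply/seteqP; split => t; rewrite /side /= (negbTE iS) leNgt.
    by move=> ->.
  by move/negbTE.
apply: eq_bigr => i iS.
rewrite /ecdf -probability_setC; last exact: (measurable_preimage i _ (measurable_le y)).
congr (P _); apply/seteqP; split => t; rewrite /side /= iS leNgt.
  by move=> ->.
by move/negP; rewrite negbK.
Qed.

Lemma wlp_exceedance y :
  [set t | y < eitv_val (p (fun i => X i t))] =
  \bigcup_(S in [set S | y < eitv_val (p (vertex ab S))]) exceedance_event y S.
Proof.
apply/seteqP; split => t /=.
  move=> yp; exists [set i | y < eitv_val (X i t)]%SET => /=.
    rewrite -(wlp_threshold_vertex ab _ _ _ (fun i => X i t) _ wlp_p)// => i.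
    by rewrite inE.
  by move=> i; rewrite inE.
by move=> [S /= yS tS]; rewrite (wlp_threshold_vertex ab _ _ _ _ S wlp_p tS).
Qed.

Lemma measurable_wlp_gt y : measurable [set t | y < eitv_val (p (fun i => X i t))].
Proof.
rewrite wlp_exceedance; apply: fin_bigcup_measurable => [|S _].
  exact: finite_finset.
exact: measurable_exceedance_event.
Qed.

Lemma probability_wlp_gt y :
  P [set t | y < eitv_val (p (fun i => X i t))] =
  \sum_(S | y < eitv_val (p (vertex ab S))) P (exceedance_event y S).
Proof.
rewrite wlp_exceedance measure_fin_bigcup//.
- rewrite -(@bigfs _ _ _ _ (index_enum _)) ?index_enum_uniq//.
  by move=> S _; rewrite mem_index_enum.
- exact: finite_finset.
- move=> S S' _ _ [t [tS tS']]; apply/setP => i.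
  by rewrite -tS -tS'.
- by move=> S _; exact: measurable_exceedance_event.
Qed.

End tail.

(** * Integrals of left-tag step functions *)

Section step_integral.
Context {R : realType} (mu : probability (\bar R) R).
Implicit Types (x y : \bar R) (s : seq (\bar R)).

(** The step function is a linear combination of indicators of the half-lines []u, +oo]].
    Integrability is carried along because additivity of the integral requires it at each step of
    the induction. *)
Lemma integral_left_tags (g : \bar R -> R) x s :
  mu.-integrable setT
    (fun y => (cell_sum (fun u v => (u < y)%E%:R * (g v - g u)) x s)%:E) /\
  \int[mu]_y (cell_sum (fun u v => (u < y)%E%:R * (g v - g u)) x s)%:E =
  (cell_sum (fun u v => fine (mu [set y | (u < y)%E]) * (g v - g u)) x s)%:E.
Proof.
elim: s x => [|z s IH] x /=; first by split; [exact: integrable0|exact: integral0].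
have [intz intzE] := IH z.
pose i y := (g z - g x)%:E * (\1_[set y | (x < y)%E] y)%:E.
have int1 := integrable_indic mu (measurable_gt x).
have inti : mu.-integrable setT i by exact: integrableZl.
have -> : (fun y => ((x < y)%E%:R * (g z - g x) +
    cell_sum (fun u v => (u < y)%E%:R * (g v - g u)) z s)%:E) =
    (fun y => i y + (cell_sum (fun u v => (u < y)%E%:R * (g v - g u)) z s)%:E).
  by apply/funext => y; rewrite EFinD /i -EFinM mulrC indicE mem_setE.
split; first exact: integrableD.
rewrite integralD// intzE integralZl// integral_indic//; last exact: measurable_gt.
by rewrite setIT [RHS]EFinD muleC EFinM fineK// fin_num_measure//; exact: measurable_gt.
Qed.

Lemma cvg_integral_left_tags (g : \bar R -> R) (B : R)
    (s_ : nat -> seq (\bar R)) :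
  measurable_fun setT g -> (forall y, (`|g y| <= B)%R) ->
  (forall m, division -oo +oo (s_ m)) ->
  (forall y, (g -oo%E +
        cell_sum (fun u v => (u < y)%E%:R * (g v - g u)) -oo%E (s_ m))%R
        @[m --> \oo] --> g y) ->
  (g -oo%E + cell_sum (fun u v => fine (mu [set y | (u < y)%E]) * (g v - g u))
     -oo%E (s_ m))%:E @[m --> \oo] --> \int[mu]_y (g y)%:E.
Proof.
move=> mg gB ds gs.
pose h m y := (g -oo%E +
  cell_sum (fun u v => (u < y)%E%:R * (g v - g u)) -oo%E (s_ m))%:E.
have int_cst (c : R) : mu.-integrable setT (cst c%:E).
  exact: finite_measure_integrable_cst.
have int_h m : mu.-integrable setT (h m).
  rewrite /h; under eq_fun do rewrite EFinD.
  have [int_s _] := integral_left_tags g -oo%E (s_ m).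
  exact: (integrableD measurableT (int_cst _) int_s).
have int_hE m : \int[mu]_y h m y = (g -oo%E + cell_sum (fun u v =>
    fine (mu [set y | (u < y)%E]) * (g v - g u)) -oo%E (s_ m))%:E.
  have [int_s int_sE] := integral_left_tags g -oo%E (s_ m).
  rewrite /h; under eq_integral do rewrite EFinD.
  rewrite (integralD measurableT (int_cst _) int_s) int_sE integral_cst//.
  rewrite EFinD -[X in _ = X + _]mule1; congr (_ * _ + _).
  exact: probability_setT.
have [] := @dominated_convergence _ _ _ mu setT measurableT h (EFin \o g)
  (cst B%:E).
- by move=> m; exact: measurable_int (int_h m).
- exact/measurable_EFinP.
- by apply: aeW => y _; apply: cvg_comp (gs y) _; exact: cvg_id.
- exact: int_cst.
(* Domination: each value of a step function is a value of [g]. *)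
- apply: aeW => y m _ /=; rewrite lee_fin.
  have [ps ls] := ds m.
  have [|c [_ _ _ ->]] := step_value g -oo%E (s_ m) y ps; last exact: gB.
  by rewrite ls leey.
move=> _ _; apply: cvg_trans; apply: near_eq_cvg; apply: nearW => m /=.
by rewrite -int_hE.
Qed.

End step_integral.

(** * Stieltjes integrals as limits of left-tagged sums *)

Section left_tags.
Context {R : realType}.
Implicit Types (u v x y : \bar R) (s : seq (\bar R)).

Lemma nth_belast {A : Type} (x0 x : A) (s : seq A) j : (j < size s)%N ->
  nth x0 (belast x s) j = nth x0 (x :: s) j.
Proof. by move=> js; rewrite lastI nth_rcons size_belast js. Qed.

Lemma tags_belast u s : path <%O u s -> tags u s (belast u s).
Proof.
move=> us; split; first exact: size_belast.
move=> j js; rewrite nth_belast// lexx /= ltW//.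
exact: (pathP u us).
Qed.

Lemma stieltjes_sum_belast (f g : \bar R -> R) u s :
  stieltjes_sum (EFin \o f) (EFin \o g) u (s, belast u s) =
  (cell_sum (fun x y => f x * (g y - g x)) u s)%:E.
Proof.
rewrite -(cell_sumE _ u) -sumEFin; apply: eq_bigr => j _.
by rewrite nth_belast.
Qed.

(** One cell suffices: from [y] to [+oo], or from [-oo] to [+oo] if [y] is [+oo]. *)
Lemma ebounded_variation_fin (g : \bar R -> \bar R) :
  ebounded_variation g -> forall y, g y \is a fin_num.
Proof.
move=> [M gM] y.
have fin_lt x z : x < z -> (g x \is a fin_num) && (g z \is a fin_num).
  move=> xz; have := gM x [:: z]; rewrite /= xz => /(_ isT).
  rewrite big_ord_recl big_ord0 /= adde0.
  by case: (g x) (g z) => [?||] [?||].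
have [->|yoo] := eqVneq y +oo; first by have /andP[] := fin_lt -oo +oo isT.
by have /andP[] : (g y \is a fin_num) && (g +oo \is a fin_num) by rewrite fin_lt// ltey.
Qed.

Lemma ebounded_variation_cell_sum (g : \bar R -> R) :
  ebounded_variation (EFin \o g) -> exists M : R, forall x s, path <%O x s ->
  (cell_sum (fun u v => `|g v - g u|) x s <= M)%R.
Proof.
move=> [M gM]; exists M => x s xs; rewrite -lee_fin (le_trans _ (gM x s xs))//.
rewrite -(cell_sumE _ x) -sumEFin le_eqVlt; apply/orP; left; apply/eqP.
by apply: eq_bigr => j _.
Qed.

(** Left endpoints are admissible tags, so left-tagged sums follow the limit. As [f] has values in
    [[0, 1]], these sums are bounded by [M], which rules out an infinite limit. *)
Lemma stieltjes_integral_left_tags (f g : \bar R -> R) (M : R) u v :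
  (forall y, 0 <= f y <= 1)%R ->
  (forall x s, path <%O x s ->
    (cell_sum (fun u v => `|g v - g u|) x s <= M)%R) ->
  stieltjes_integrable (EFin \o f) (EFin \o g) u v ->
  exists2 I : R, stieltjes_integral (EFin \o f) (EFin \o g) u v = I%:E &
    forall e : R, (0 < e)%R -> exists2 s0, division u v s0 &
      forall s, division u v s -> {subset s0 <= s} ->
        (`|I - cell_sum (fun x y => f x * (g y - g x)) u s| <= e)%R.
Proof.
move=> f01 gM; rewrite /stieltjes_integrable /stieltjes_integral.
set l := lim _ => fg.
have left_sum (A : set (\bar R)) : nbhs l A -> exists2 s0, division u v s0 &
    forall s, division u v s -> {subset s0 <= s} ->
    A (cell_sum (fun x y => f x * (g y - g x)) u s)%:E.
  move=> /fg[s0 us0 s0A]; exists s0 => // s us s0s.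
  rewrite -stieltjes_sum_belast; apply: s0A => //.
  by apply: tags_belast; have [] := us.
have sum_le s : division u v s ->
    (`|cell_sum (fun x y => f x * (g y - g x)) u s| <= M)%R.
  move=> [us _]; rewrite (le_trans (normr_cell_sum _ _ _))//.
  apply: le_trans (gM _ _ us); apply: le_cell_sum => x y.
  have /andP[f0 f1] := f01 x.
  by rewrite normrM (ger0_norm f0) ler_piMl.
case: l left_sum {fg} => [I|infl|infl].
- move=> finl; exists I => // e e0.
  pose A := [set r | (`|I - r| <= e)%R].
  have [|s0 us0 s0A] := finl [set r%:E | r in A].
    apply: nbhs_image_EFin; apply/nbhs_ballP; exists e => //= r.
    exact: ltW.
  by exists s0 => // s us /(s0A _ us)[r Ar [<-]].
- have [|s0 us0 /(_ _ us0 (fun _ => id))] := infl [set y | M%:E < y].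
    exact: nbhs_open_ereal_pinfty.
  by rewrite /= lte_fin ltNge (le_trans (ler_norm _))// sum_le.
- have [|s0 us0 /(_ _ us0 (fun _ => id))] := infl [set y | y < (- M)%:E].
    exact: nbhs_open_ereal_ninfty.
  by rewrite /= lte_fin ltNge lerNl (le_trans (ler_norm _))// normrN sum_le.
Qed.

(** The truncation ends at [v] because [v] is the last point of [s0], hence a point of [s], unless
    [s0] is empty and [v] is [-oo]. *)
Lemma division_filter s v s0 : division -oo +oo s -> division -oo v s0 ->
  {subset s0 <= s} ->
  division -oo v [seq z <- s | z <= v] /\
  {subset s0 <= [seq z <- s | z <= v]}.
Proof.
move=> [ps ls] [ps0 ls0] s0s.
have sub : {subset s0 <= [seq z <- s | z <= v]}.
  move=> z zs0; rewrite mem_filter s0s// andbT -ls0.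
  by apply: (path_max _ _ ps0); rewrite in_cons zs0 orbT.
have pf : path <%O -oo [seq z <- s | z <= v] by exact: (path_filter lt_trans).
split=> //; split=> //; apply: le_anti; apply/andP; split.
  have := mem_last -oo [seq z <- s | z <= v].
  by rewrite in_cons mem_filter => /predU1P[->|/andP[]//]; exact: leNye.
apply: (path_max _ _ pf); rewrite in_cons.
by have := mem_last -oo s0; rewrite ls0 in_cons => /predU1P[->|/sub ->]; rewrite ?eqxx ?orbT.
Qed.

End left_tags.

(** * Measures of total mass one as probabilities *)

Section probability_of_measure.
Context {d : measure_display} {T : measurableType d} {R : realType}.
Context (mu : {measure set T -> \bar R}) (mu1 : mu setT = 1).

(** An alias that carries the proof of the total mass, as a key for the probability structure. *)
Definition normed_measure of mu setT = 1 : set T -> \bar R := mu.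

Let nu := normed_measure mu1.
HB.instance Definition _ := Measure.on nu.
HB.instance Definition _ := Measure_isProbability.Build _ _ _ nu mu1.

Definition probability_of_measure : probability T R := nu.

End probability_of_measure.

(** * The expected value as a sum of Stieltjes integrals *)

Theorem mainTheorem3 (R : realType) (a b : \bar R) (ab : a <= b)
  (n : nat) (n_gt0 : (0 < n)%N)
  (d : measure_display) (T : measurableType d) (P : probability T R)
  (X : 'I_n -> T -> eitv a b)
  (mX : forall i, measurable_fun [set: T] (fun t => eitv_val (X i t)))
  (indepX : mutually_independent P (fun i t => eitv_val (X i t)))
  (F : 'I_n -> \bar R -> \bar R)
  (FE : forall i, F i = ecdf P (fun t => eitv_val (X i t)))
  (p : ('I_n -> eitv a b) -> eitv a b)
  (wlp_p : weighted_lattice_polynomial p)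
  (Fp : \bar R -> \bar R)
  (FpE : Fp = ecdf P (fun t => eitv_val (p (fun i => X i t))))
  (dFp : {measure set (\bar R) -> \bar R})
  (dFpE : stieltjes_measure Fp dFp)
  (g : \bar R -> \bar R)
  (mg : measurable_fun [set: \bar R] g)
  (bvg : ebounded_variation g)
  (limg : forall i, g y%:E * (1 - F i y%:E) @[y --> +oo%R] --> 0)
  (intg : forall S : {set 'I_n},
    stieltjes_integrable
      (fun y => \prod_(i in ~: S) F i y * \prod_(i in S) (1 - F i y))
      g -oo (eitv_val (p (vertex ab S)))) :
  \int[dFp]_y g y =
  g -oo + \sum_(S : {set 'I_n})
    stieltjes_integral
      (fun y => \prod_(i in ~: S) F i y * \prod_(i in S) (1 - F i y))
      g -oo (eitv_val (p (vertex ab S))).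
Proof.
have dFpT : dFp setT = 1.
  transitivity (Fp +oo); last first.
    rewrite FpE /ecdf -(probability_setT P); congr (P _).
    by apply/seteqP; split => t //= _; rewrite leey.
  by rewrite -dFpE; congr (dFp _); apply/seteqP; split => t //= _; rewrite leey.
pose mu := probability_of_measure dFp dFpT.
(* The integrand as a real function; being a probability, it lies in [[0, 1]]. *)
pose weight S y := fine (P (exceedance_event X y S)).
pose gr y := fine (g y).
have g_fin := ebounded_variation_fin g bvg.
have gE : g = EFin \o gr by apply/funext => y; rewrite /= fineK.
have event_fin y S : P (exceedance_event X y S) \is a fin_num.
  by rewrite fin_num_measure//; exact: measurable_exceedance_event.
have weightE S : (fun y => \prod_(i in ~: S) F i y * \prod_(i in S) (1 - F i y))
    = EFin \o weight S.
  apply/funext => y; rewrite /weight /= fineK//.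
  rewrite (probability_exceedance_event P X mX indepX).
  by congr (_ * _); apply: eq_bigr => i _; rewrite FE.
have weight01 S y : (0 <= weight S y <= 1)%R.
  rewrite -!lee_fin fineK// measure_ge0 probability_le1//.
  exact: measurable_exceedance_event.
have bvgr : ebounded_variation (EFin \o gr) by rewrite -gE.
have [M gM] := ebounded_variation_cell_sum gr bvgr.
have gB y : (`|gr y| <= `|gr -oo%E| + M)%R.
  have [->|yNy] := eqVneq y -oo.
    by rewrite lerDl; apply: (gM -oo [::]).
  have := gM -oo [:: y]; rewrite /= ltNye yNy addr0 => /(_ isT) gyM.
  rewrite -lerBlDl (le_trans _ gyM)// (le_trans (lerB_dist _ _))//.
have mgr : measurable_fun setT gr by apply/measurable_EFinP; rewrite -gE.
have [I IE Iapprox] : exists2 I : {set 'I_n} -> R,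
    (forall S, stieltjes_integral (EFin \o weight S) (EFin \o gr) -oo
      (eitv_val (p (vertex ab S))) = (I S)%:E) &
    forall (e : R) S, (0 < e)%R -> exists2 s0, division -oo (eitv_val (p (vertex ab S))) s0 &
      forall s, division -oo (eitv_val (p (vertex ab S))) s -> {subset s0 <= s} ->
      (`|I S - cell_sum (fun x y => weight S x * (gr y - gr x)) -oo s| <= e)%R.
  have /choice[I IP] S : exists I : R,
      stieltjes_integral (EFin \o weight S) (EFin \o gr) -oo
        (eitv_val (p (vertex ab S))) = I%:E /\
      forall e : R, (0 < e)%R -> exists2 s0, division -oo (eitv_val (p (vertex ab S))) s0 &
      forall s, division -oo (eitv_val (p (vertex ab S))) s -> {subset s0 <= s} ->
      (`|I - cell_sum (fun x y => weight S x * (gr y - gr x)) -oo s| <= e)%R.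
    have intS := intg S; rewrite weightE gE in intS.
    have [J JE Japprox] := stieltjes_integral_left_tags _ _ M _ _ (weight01 S) gM intS.
    by exists J.
  by exists I => [S|e S]; have [IE Iapprox] := IP S; [exact: IE|exact: Iapprox].
(* [dFp] is only known on the sets [[set z | z <= y]], so tails are reached through complements. *)
have tailE y : fine (mu [set z | y < z]) =
    (\sum_(S | (y < eitv_val (p (vertex ab S)))%E) weight S y)%R.
  have -> : mu [set z | y < z] = P [set t | y < eitv_val (p (fun i => X i t))].
    have gtC (U : Type) (Z : U -> \bar R) :
        [set t | y < Z t] = ~` [set t | Z t <= y].
      by apply/seteqP; split => t /=; rewrite ltNge => /negP.
    rewrite (gtC _ idfun) probability_setC; last exact: measurable_le.
    rewrite dFpE FpE /ecdf -probability_setC -?gtC//.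
    by rewrite -[X in measurable X]setCK -gtC; apply: measurableC; exact: measurable_wlp_gt.
  rewrite (probability_wlp_gt ab P X mX p wlp_p) -EFin_sum_fine//.
rewrite (eq_bigr (fun S => (I S)%:E)); last by move=> S _; rewrite weightE gE IE.
rewrite gE sumEFin -EFinD.
have int_gr : mu.-integrable setT (EFin \o gr).
  apply: measurable_bounded_integrable => //.
    by apply: (le_lt_trans (probability_le1 mu measurableT)); exact: ltry.
  exists (`|gr -oo%E| + M)%R; split; first exact: num_real.
  by move=> B /ltW ltB y _; exact: le_trans (gB y) ltB.
have := integrable_fin_num measurableT int_gr.
rewrite -[X in _ -> X = _]/(\int[mu]_y (gr y)%:E).
case E : (\int[mu]_y (gr y)%:E) => [J||] // _; congr EFin.
apply/eqP; rewrite -subr_eq0 -normr_le0; apply/ler_addgt0Pl => e e0; rewrite addr0.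
(* The error [e] is cut into [N + 1] equal shares: one for the expected value and one for the
   integral of each [S]. *)
pose N := #|{set 'I_n}|.
pose e' := (e / N.+1%:R)%R.
have e'0 : (0 < e')%R by rewrite divr_gt0.
have /choice[s0 s0P] S : exists s0, division -oo (eitv_val (p (vertex ab S))) s0 /\
      forall s, division -oo (eitv_val (p (vertex ab S))) s -> {subset s0 <= s} ->
      (`|I S - cell_sum (fun x y => weight S x * (gr y - gr x)) -oo s| <= e')%R.
  by have [s0 ds0 s0P] := Iapprox e' S e'0; exists s0.
(* Prescribing the points of all [s0 S] makes every [s_ m], truncated at [p(e_S)], a refinement of
   [s0 S]. *)
have [s_ [ds s0s gs]] :=
  exists_step_approximation gr M gM (flatten [seq s0 A | A <- enum {set 'I_n}]).
have := cvg_integral_left_tags mu gr _ s_ mgr gB ds gs.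
rewrite E => /fine_cvgP[_ /cvgrPdist_le /(_ _ e'0)].
case=> m _ /(_ m (leqnn _)) /=.
rewrite (_ : cell_sum _ _ _ = \sum_(S : {set 'I_n}) cell_sum
    (fun x y => weight S x * (gr y - gr x)) -oo
    [seq z <- s_ m | (z <= eitv_val (p (vertex ab S)))%E])%R => [Jm|].
  have -> : (J - (gr -oo%E + \sum_(S : {set 'I_n}) I S) =
    (J - (gr -oo%E + \sum_(S : {set 'I_n}) cell_sum
    (fun x y => weight S x * (gr y - gr x)) -oo
    [seq z <- s_ m | (z <= eitv_val (p (vertex ab S)))%E])) -
    \sum_(S : {set 'I_n}) (I S - cell_sum
    (fun x y => weight S x * (gr y - gr x)) -oo
    [seq z <- s_ m | (z <= eitv_val (p (vertex ab S)))%E]))%R.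
    by rewrite sumrB; lra.
  rewrite (le_trans (ler_normB _ _))// (_ : e = e' + N%:R * e')%R; last first.
    by rewrite /e' -natr1; field; rewrite natr1.
  rewrite lerD// (le_trans (ler_norm_sum _ _ _))//.
  rewrite mulr_natl -sumr_const; apply: ler_sum => S _.
  have [ds0 s0P'] := s0P S.
  have s0_sub : {subset s0 S <= s_ m}.
    move=> z zs0; apply: s0s.
      by have [/(order_path_min lt_trans)/allP ->] := ds0.
    by apply/flattenP; exists (s0 S) => //; apply: map_f; rewrite mem_enum.
  by have [dsf subf] := division_filter _ _ _ (ds m) ds0 s0_sub; exact: s0P'.
(* Each truncation becomes a factor [x < p(e_S)] on a common division; exchanging the sums over [S]
   and over cells, [tailE] applies cell by cell. *)
rewrite [RHS](eq_bigr (fun S => cell_sum (fun x y =>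
    (x < eitv_val (p (vertex ab S)))%E%:R * weight S x * (gr y - gr x)) -oo%E (s_ m))%R).
  rewrite cell_sum_sum; apply: eq_cell_sum => x y _.
  rewrite tailE big_mkcond mulr_suml; apply: eq_bigr => S _.
  by case: ifP => _; rewrite ?mul1r// !mul0r.
move=> S _; have [ps ls] := ds m.
rewrite cell_sum_filter ?leNye//.
have [[ps0 ls0] _] := s0P S.
have := mem_last -oo (s0 S); rewrite ls0 !in_cons => /predU1P[->|zs0].
  by rewrite eqxx.
have [->|vNy] := eqVneq (eitv_val (p (vertex ab S))) -oo; first by rewrite ?eqxx.
rewrite s0s ?orbT// ?ltNye//.
by apply/flattenP; exists (s0 S) => //; apply: map_f; rewrite mem_enum.
Qed.
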